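(* Let $p\ge 5$ be a prime. A $\Phi_{\frac{p-1}{2}}$-sequence $(a_n)_{n\in\mathbb{Z}}$ in $\mathbb{F}_p$ is complete if and only if $a_n=b^n$ for all $n$, where $b$ is a $\Phi_{\frac{p-1}{2}}$-primitive root. Moreover, in this case $b=p-2$.
   Context: For a prime $p\ge 5$ and $\kappa\in\{2,\dots,p-2\}$, a sequence $(a_n)_{n\in\mathbb{Z}}$ of elements of $\mathbb{F}_p$ is a $\Phi_\kappa$-sequence if $a_0=1$ and $a_{n+\kappa}=a_n+a_{n+1}$ in $\mathbb{F}_p$ for all $n\in\mathbb{Z}$. It is complete if it is periodic with period $p-1$ and $\{a_1,\dots,a_{p-2}\}=\{2,\dots,p-1\}$. A $\Phi_\kappa$-primitive root is a primitive root $b$ mod $p$ (in $\mathbb{F}_p$) with $b^\kappa=b+1$. *)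

(* Defs.v *)
From mathcomp Require Import all_boot all_order all_algebra.

Set Implicit Arguments.
Unset Strict Implicit.
Unset Printing Implicit Defensive.

Import GRing.Theory.
Local Open Scope ring_scope.

(* In the three definitions below p is meant to be a prime (for other values
   'F_p is the field of integers modulo the least prime divisor of p). *)

Definition phi_sequence (p kappa : nat) (a : int -> 'F_p) : Prop :=
  a 0 = 1 /\ forall n : int, a (n + kappa%:Z) = a n + a (n + 1).

(* No minimality of the period is required; it follows from the second
   condition and a 0 = 1, which make a 0, ..., a (p - 2) pairwise distinct. *)
Definition phi_complete (p : nat) (a : int -> 'F_p) : Prop :=
  (forall n : int, a (n + (p - 1)%N%:Z) = a n) /\
  [set a (i : nat)%:Z | i : 'I_p & (1 <= i <= p - 2)%N]
    = [set (m : nat)%:R | m : 'I_p & (2 <= m <= p - 1)%N].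

Definition phi_primitive_root (p kappa : nat) (b : 'F_p) : Prop :=
  (p - 1).-primitive_root b /\ b ^+ kappa = b + 1.

(* Main.v *)
Require Import Defs.
From mathcomp Require Import all_boot all_order all_algebra all_field.
From mathcomp Require Import ring zify.

(* Put k = (p - 1) / 2. If a has period 2k, applying the recurrence twice gives
   a_n = a_(n+2k) = a_n + 2 a_(n+1) + a_(n+2), hence a_(n+2) = -2 a_(n+1) for
   all n, that is a_n = (-2)^n. Completeness prevents a_m = 1 for
   0 < m < p - 1, so -2 has order p - 1. Conversely, a primitive root b
   satisfies b^k = -1, so that b^k = b + 1 forces b = -2. *)

Set Implicit Arguments.
Unset Strict Implicit.
Unset Printing Implicit Defensive.

Import GRing.Theory.
Local Open Scope ring_scope.

Lemma geometric_int_seq (F : fieldType) (b : F) (a : int -> F) :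
  b != 0 -> a 0 = 1 -> (forall n, a (n + 1) = b * a n) ->
  forall n : int, a n = b ^ n.
Proof.
move=> b0 a0 aS; elim/int_ind => [|n IHn|n IHn]; first by rewrite a0 expr0z.
- by rewrite -addn1 PoszD aS IHn expfzDr // expr1z mulrC.
(* The downward step: cancelling [b] reduces the claim at [- n.+1] to the one at [- n], which is why
   [b] must be invertible. *)
- apply: (mulfI b0); rewrite -aS -[X in X * _]expr1z -expfzDr // addrC.
  have -> : 1 + - n.+1%:Z = - n%:Z by lia.
  exact: IHn.
Qed.

Lemma prim_root_neq0 (F : fieldType) n (z : F) :
  n.-primitive_root z -> z != 0.
Proof.
move=> zP; apply: contra_eq_neq (prim_expr_order zP) => ->.
by rewrite expr0n gtn_eqF ?(prim_order_gt0 zP) // eq_sym oner_eq0.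
Qed.

(** The square of [z ^+ k] is 1, so [z ^+ k] is 1 or -1; the value 1 would make [k + k] divide
    [k]. *)
Lemma prim_root_half (F : fieldType) k (z : F) :
  (0 < k)%N -> (k + k).-primitive_root z -> z ^+ k = -1.
Proof.
move=> k_gt0 zP; have /eqP := prim_expr_order zP.
rewrite exprD -expr2 sqrf_eq1 => /orP[|/eqP//].
by rewrite -(prim_order_dvd zP) => /(dvdn_leq k_gt0); lia.
Qed.

Lemma Fp_expf_pred p (x : 'F_p) : prime p -> x != 0 -> x ^+ (p - 1) = 1.
Proof.
move=> p_pr x0; apply: (mulfI x0); rewrite -exprS mulr1.
have -> : (p - 1).+1 = #|'F_p|.
  by rewrite card_Fp //; have := prime_gt1 p_pr; lia.
exact: expf_card.
Qed.

(** Turns the target set of completeness into two disequalities; the canonical representative of [x]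
    is the witness. *)
Lemma mem_Fp_ge2 p (x : 'F_p) : prime p ->
  (x \in [set ((m : nat)%:R : 'F_p) | m : 'I_p & (2 <= m <= p - 1)%N])
    = (x != 0) && (x != 1).
Proof.
move=> p_pr; have p_gt1 := prime_gt1 p_pr.
have natE (n : nat) : (n < p)%N -> (n%:R : 'F_p) = n :> nat.
  by move=> ltnp; rewrite val_Fp_nat // modn_small.
have oneE : (1 %% (Zp_trunc (pdiv p)).+2 = 1)%N.
  by rewrite Fp_cast // modn_small.
apply/imsetP/andP => [[m /[!inE] /andP[m_ge2 _] ->]|[x0 x1]].
  split; apply/eqP => /(congr1 val) /=.
    by rewrite natE ?ltn_ord //; lia.
  by rewrite natE ?ltn_ord // oneE; lia.
have x_lt : (x < p)%N by rewrite -[X in (_ < X)%N](Fp_cast p_pr) ltn_ord.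
exists (Ordinal x_lt); last by apply: val_inj; rewrite /= natE.
rewrite inE /=; move: x0 x1; rewrite -!val_eqE /= oneE; lia.
Qed.

Lemma phi_complete_expz p (b : 'F_p) (a : int -> 'F_p) : prime p ->
  (p - 1).-primitive_root b -> (forall n : int, a n = b ^ n) ->
  phi_complete a.
Proof.
move=> p_pr bP aE; have b0 := prim_root_neq0 bP; have p_gt1 := prime_gt1 p_pr.
split=> [n|].
  by rewrite !aE expfzDr // -exprnP (prim_expr_order bP) mulr1.
apply/setP=> x; rewrite mem_Fp_ge2 //.
apply/imsetP/andP => [[i /[!inE] i_bd ->]|[x0 x1]].
  rewrite aE -exprnP expf_neq0 // -(prim_order_dvd bP); split=> //.
  by apply/negP=> /dvdn_leq; lia.
(* By Fermat, [x] is a root of unity of order dividing [p - 1], hence a power of [b]; the exponent 0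
   is excluded by [x != 1]. *)
have [i xE] := prim_rootP bP (Fp_expf_pred p_pr x0).
have i_lt : (i < p)%N by have := ltn_ord i; lia.
exists (Ordinal i_lt); last by rewrite aE -exprnP.
rewrite inE /=; have := ltn_ord i.
have : (i : nat) != 0%N by apply: contra_neq x1 => i0; rewrite xE i0.
lia.
Qed.

(** If the order [m] of [b] were less than [p - 1], the value [a m = 1] would lie in the range,
    which omits 1. *)
Lemma phi_complete_prim_root p (b : 'F_p) (a : int -> 'F_p) : prime p ->
  b != 0 -> phi_complete a -> (forall n : int, a n = b ^ n) ->
  (p - 1).-primitive_root b.
Proof.
move=> p_pr b0 [_ a_range] aE; have p_gt1 := prime_gt1 p_pr.
have p1_gt0 : (0 < p - 1)%N by lia.
have [m bP m_dvd] := prim_order_exists p1_gt0 (Fp_expf_pred p_pr b0).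
have m_gt0 := prim_order_gt0 bP; have m_le := dvdn_leq p1_gt0 m_dvd.
have [<-//|m_neq] := eqVneq m (p - 1)%N.
have m_lt : (m < p)%N by lia.
have : a m%:Z \in [set a (i : nat)%:Z | i : 'I_p & (1 <= i <= p - 2)%N].
  by apply/imsetP; exists (Ordinal m_lt) => //; rewrite inE /=; lia.
by rewrite a_range mem_Fp_ge2 // aE -exprnP (prim_expr_order bP) eqxx andbF.
Qed.

Lemma phi_sequence_half_period p k (a : int -> 'F_p) :
  phi_sequence k a -> (forall n : int, a (n + (k + k)%N%:Z) = a n) ->
  forall n, a (n + 1) = - 2 * a n.
Proof.
(* Starting at [n - 1] makes the double recurrence involve [a (n - 1)], [a n] and [a (n + 1)]; the
   first cancels. *)
move=> [_ a_rec] a_per n; have := a_per (n - 1).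
rewrite PoszD addrA !a_rec.
have -> : n - 1 + k%:Z + 1 = n + k%:Z by ring.
rewrite a_rec subrK => eq_a.
apply/eqP; rewrite -subr_eq0 -[X in _ == X](subrr (a (n - 1))) -{1}eq_a.
by apply/eqP; ring.
Qed.

Theorem theorem5p7 (p : nat) (p_prime : prime p) (p_ge5 : (5 <= p)%N)
    (a : int -> 'F_p) (ha : phi_sequence ((p - 1) %/ 2)%N a) :
  (phi_complete a <->
     exists b : 'F_p, phi_primitive_root ((p - 1) %/ 2)%N b /\
                      forall n : int, a n = b ^ n) /\
  (forall b : 'F_p, phi_primitive_root ((p - 1) %/ 2)%N b ->
     (forall n : int, a n = b ^ n) -> b = (p - 2)%:R).
Proof.
set k := ((p - 1) %/ 2)%N in ha *.
have kk : (p - 1 = k + k)%N.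
  have [p2|p_odd] := even_prime p_prime; first by lia.
  by rewrite /k; lia.
have two_neq0 : (2 : 'F_p) != 0.
  rewrite -(dvdn_pcharf (pchar_Fp p_prime)); apply/negP => /dvdn_leq; lia.
split; last first.
  move=> b [bP b_k] _.
  have := prim_root_half (k := k) _ (z := b); rewrite -kk b_k => /(_ _ bP) bE.
  rewrite natrB ?pchar_Fp_0 //; last by lia.
  (* Here [b + 1 = b ^+ k = -1], and [p] is 0 in ['F_p], so both sides plus 1 equal -1. *)
  apply: (addIr 1); rewrite bE; last by lia.
  by ring.
split=> [a_complete|[b [[bP _] aE]]]; last exact: phi_complete_expz bP aE.
have b0 : - 2 != 0 :> 'F_p by rewrite oppr_eq0.
have [a0 a_rec] := ha.
have a_per (n : int) : a (n + (k + k)%N%:Z) = a n.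
  by rewrite -kk; case: a_complete.
have aE := geometric_int_seq b0 a0 (phi_sequence_half_period ha a_per).
exists (- 2); split=> //; split.
  exact: phi_complete_prim_root a_complete aE.
(* For [b = - 2], the recurrence at index 0 is exactly [b ^+ k = b + 1]. *)
by have := a_rec 0; rewrite !add0r !aE expr0z expr1z addrC.
Qed.
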